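(* Let $(X,r)$ be a finite non-degenerate, involutive set-theoretic solution of the quantum Yang-Baxter equation. The following are equivalent: 1. $(X,r)$ is an indecomposable solution. 2. There exist a left brace $A$ and an element $x\in A$ such that $X=\{x+a\cdot x : a\in A\}$ and every element of $A$ is a (finite) sum of elements from $X$; moreover, $r$ is the restriction to $X\times X$ of the Yang-Baxter map associated to $A$.
   Context: A set-theoretic solution of the quantum Yang-Baxter equation (QYBE) is a pair $(X,r)$ with $X$ a non-empty set and $r:X\times X\to X\times X$ a bijection, written $r(x,y)=(\sigma_x(y),\tau_y(x))$, satisfying $r_1r_2r_1=r_2r_1r_2$ on $X^3$, where $r_1=r\times \mathrm{id}_X$, $r_2=\mathrm{id}_X\times r$. It is non-degenerate if all $\sigma_x,\tau_x$ are permutations of $X$, and involutive if $r^2=\mathrm{id}$. A non-degenerate solution $(X,r)$ is decomposable if there are non-empty disjoint subsets $X_1,X_2\subseteq X$ with $X=X_1\cup X_2$ and $r(X_i\times X_j)=X_j\times X_i$ for all $i,j\in\{1,2\}$; otherwise it is indecomposable. A left brace is an abelian group $(A,+)$ with a multiplication $\cdot$ such that $a\cdot(b+c)=a\cdot b+a\cdot c$ and the operation $a\circ b=a\cdot b+a+b$ makes $A$ a group. The identity elements of $(A,+)$ and $(A,\circ)$ coincide and are denoted $0$. The Yang-Baxter map associated to $A$ is $r':A\times A\to A\times A$, $r'(x,y)=(x\cdot y+y,\ z\cdot x+x)$, where $z$ is the unique element with $z\cdot(x\cdot y+y)+z+x\cdot y+y=0$ (i.e. $z$ is the $\circ$-inverse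 of $x\cdot y+y$). A map $r:X\times X\to X\times X$ with $X\subseteq A$ is a restriction of $r'$ if $r(x,y)=r'(x,y)$ for all $x,y\in X$. *)

(* Defs.v *)
From mathcomp Require Import all_boot all_order all_algebra.

Set Implicit Arguments.
Unset Strict Implicit.
Unset Printing Implicit Defensive.

Import GRing.Theory.
Local Open Scope ring_scope.

Section Solutions.
Variables (X : finType) (r : X * X -> X * X).

Definition sigma (x y : X) : X := (r (x, y)).1.
Definition tau (y x : X) : X := (r (x, y)).2.

Definition r1 (t : X * X * X) : X * X * X :=
  let: (x, y, z) := t in (r (x, y), z).

Definition r2 (t : X * X * X) : X * X * X :=
  let: (x, y, z) := t in let: (y', z') := r (y, z) in (x, y', z').

Definition qybe_solution : Prop :=
  [/\ (0 < #|X|)%N,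
      bijective r &
      r1 \o r2 \o r1 =1 r2 \o r1 \o r2].

Definition nondegenerate_solution : Prop :=
  (forall x, bijective (sigma x)) /\ (forall y, bijective (tau y)).

(* P false and P true are the two parts. *)
Definition decomposable : Prop :=
  exists P : bool -> {set X},
    [/\ forall i, P i != set0,
        [disjoint P false & P true],
        P false :|: P true = [set: X] &
        forall i j, r @: setX (P i) (P j) = setX (P j) (P i)].

Definition indecomposable : Prop := ~ decomposable.

End Solutions.

Definition circle (A : zmodType) (mul : A -> A -> A) (a b : A) : A :=
  mul a b + a + b.

(* The group structure of the circle operation is carried as data (identity
   and inverse), as in the library's algebraic structures; that its identity
   is the zero of (A, +) is not assumed but proved in brace_one0. *)
Record leftBrace := LeftBrace {
  brace_sort :> zmodType;
  brace_mul : brace_sort -> brace_sort -> brace_sort;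
  brace_one : brace_sort;
  brace_inv : brace_sort -> brace_sort;
  brace_mulDr : right_distributive brace_mul +%R;
  brace_circleA : associative (circle brace_mul);
  brace_circle1l : left_id brace_one (circle brace_mul);
  brace_circle1r : right_id brace_one (circle brace_mul);
  brace_circleVl : left_inverse brace_one brace_inv (circle brace_mul);
  brace_circleVr : right_inverse brace_one brace_inv (circle brace_mul)
}.

Lemma brace_one0 (A : leftBrace) : brace_one A = 0.
Proof.
have mulx0 a : brace_mul a (0 : A) = 0.
  by apply: (addIr (brace_mul a 0)); rewrite -brace_mulDr !add0r.
have := brace_circle1l (0 : A).
by rewrite /circle mulx0 add0r addr0.
Qed.

Definition yang_baxter_map (A : leftBrace) (p : A * A) : A * A :=
  let: (x, y) := p in
  let w := brace_mul x y + y in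
  (w, brace_mul (brace_inv w) x + x).

(* brace_inv w is the unique z with z . w + z + w = 0. *)
Lemma brace_invP (A : leftBrace) (w z : A) :
  brace_mul z w + z + w = 0 <-> z = brace_inv w.
Proof.
rewrite -(brace_one0 A); split=> [zw|->]; last exact: brace_circleVl.
rewrite -[z](@brace_circle1r A) -(@brace_circleVr A w) brace_circleA.
by rewrite {1}/circle -/(circle _ _ _) [circle _ z w]zw brace_circle1l.
Qed.

(* Main.v *)
Require Import Defs.
From mathcomp Require Import all_boot all_order all_algebra.
From mathcomp Require Import all_fingroup cyclic.

Set Implicit Arguments.
Unset Strict Implicit.
Unset Printing Implicit Defensive.

Import GRing.Theory.
Local Open Scope ring_scope.

(** For a left brace put lambda_a b = a.b + b.  Each lambda_a is additive,
    lambda is an action of the circle group, and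
    a + b = a o lambda_a^-1 b.  The first component of the Yang-Baxter map is
    lambda_x y, and { x + a.x } is the orbit of x under lambda.

    From a brace to indecomposability.  If X were cut into two parts, every
    lambda_u with u in X would preserve both of them.  Since X is a
    lambda-orbit, a + u = a o u' with u' = lambda_a^-1 u again in X, so by
    induction lambda_a preserves both parts whenever a is a sum of elements of
    X, that is, for every a ([sum_preserves_parts]).  This contradicts
    transitivity of lambda on X.

    From indecomposability to a brace.  Consider on the finite set Sym(X) the
    maps T_y : g |-> g sigma_(g^-1 y), composing permutations as functions.
    The braid equation and involutivity make them commute
    ([shift_fun_comm]); non-degeneracy of tau makes them bijective
    ([shift_fun_inj]).  Hence (Z/N)^X acts on Sym(X), the basis vector y acting
    as T_y, as soon as N kills every T_y.  Let pi a be the image of the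
    identity under a.  Because T_(g y) (g h) = g T_y h, the map pi satisfies
    pi (a + pi a . b) = pi a pi b ([cocycle_circle]), where Sym(X) permutes the
    coordinates of (Z/N)^X; so a o b = a + pi a . b is the circle operation of
    a brace.  As pi maps the basis vector u to sigma_u, the basis is a copy of
    (X, r), and when (X, r) is indecomposable it is a single orbit
    ([cocycle_transitive]), since an orbit and its complement would decompose
    (X, r).  Working modulo N makes every element of the brace a sum, without
    signs, of basis vectors, and N > 1 keeps these distinct. *)

(** * The lambda action of a left brace *)

Section Lambda.
Variable A : leftBrace.
Implicit Types a b c : A.

Definition lambda a b : A := brace_mul a b + b.

Lemma circleE a b : circle (@brace_mul A) a b = lambda a b + a.
Proof. by rewrite /circle /lambda addrAC. Qed.

Lemma lambdaD a b c : lambda a (b + c) = lambda a b + lambda a c.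
Proof. by rewrite /lambda brace_mulDr addrACA. Qed.

Lemma lambda_circle a b c :
  lambda (circle (@brace_mul A) a b) c = lambda a (lambda b c).
Proof.
apply: (addIr (lambda a b + a)).
by rewrite [RHS]addrA -lambdaD -!circleE brace_circleA.
Qed.

Lemma lambda0 b : lambda 0 b = b.
Proof.
by rewrite -[lambda _ _]addr0 -circleE -(brace_one0 A) brace_circle1l.
Qed.

Lemma lambdaK a : cancel (lambda a) (lambda (brace_inv a)).
Proof.
by move=> b; rewrite -lambda_circle brace_circleVl brace_one0 lambda0.
Qed.

Lemma lambdaKV a : cancel (lambda (brace_inv a)) (lambda a).
Proof.
by move=> b; rewrite -lambda_circle brace_circleVr brace_one0 lambda0.
Qed.

(** A sum is a circle product whose right factor has been moved by lambda. *)
Lemma lambda_add a b c :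
  lambda (a + b) c = lambda a (lambda (lambda (brace_inv a) b) c).
Proof. by rewrite -lambda_circle circleE lambdaKV addrC. Qed.

End Lambda.

(** * The sums of elements of one orbit preserve a decomposition *)

Section BraceToIndecomposable.
Variables (X : finType) (r : X * X -> X * X).
Variables (A : leftBrace) (iota : X -> A) (x : A).
Hypothesis orbitX :
  forall b : A, (exists u : X, b = iota u) <-> (exists a : A, b = lambda a x).
Hypothesis lambdaX : forall u v, lambda (iota u) (iota v) = iota (sigma r u v).

Lemma orbit_stable a u : exists v, lambda a (iota u) = iota v.
Proof.
have [c uE] : exists c, iota u = lambda c x by apply/orbitX; exists u.
by apply/orbitX; exists (circle (@brace_mul A) a c); rewrite lambda_circle uE.
Qed.

(** Peeling off the last summand u turns it into the circle factor
    lambda_s^-1 u, which is again in the image of iota and so acts as some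
    sigma_u'. *)
Lemma sum_preserves_parts (P : {set X}) (s : seq X) :
    (forall u v, v \in P -> sigma r u v \in P) ->
  forall v, v \in P ->
  exists2 w, w \in P & lambda (\sum_(u <- s) iota u) (iota v) = iota w.
Proof.
move=> sigmaP; elim/last_ind: s => [|s u IHs] v Pv.
  by exists v; rewrite // big_nil lambda0.
rewrite -cats1 big_cat big_seq1 lambda_add /=.
have [u' ->] := orbit_stable (brace_inv (\sum_(u <- s) iota u)) u.
by rewrite lambdaX; apply: IHs; apply: sigmaP.
Qed.

Lemma brace_indecomposable :
    injective iota ->
    (forall a : A, exists s : seq X, a = \sum_(u <- s) iota u) ->
  indecomposable r.
Proof.
move=> iota_inj sumX [P [P_n0 disP covP rP]].
have inP u : exists i, u \in P i.
  by move: (in_setT u); rewrite -covP => /setUP[]; [exists false|exists true].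
have sigmaP i u v : v \in P i -> sigma r u v \in P i.
  move=> Pv; have [j Pu] := inP u.
  have : r (u, v) \in setX (P i) (P j) by rewrite -rP imset_f // inE Pu.
  by rewrite inE => /andP[].
have [u0 xE] : exists u, x = iota u by apply/orbitX; exists 0; rewrite lambda0.
have [i Pu0] := inP u0.
have /set0Pn[v Pv] := P_n0 (~~ i).
have [a vE] : exists a, iota v = lambda a x by apply/orbitX; exists v.
have [s aE] := sumX a.
have [w Pw] := sum_preserves_parts s (sigmaP i) Pu0.
rewrite -aE -xE -vE => /iota_inj vw; rewrite -{w}vw in Pw.
by case: i Pw Pv {Pu0} => [Pt Pf|Pf Pt]; rewrite (disjointFr disP Pf) in Pt.
Qed.

End BraceToIndecomposable.

(** * Powers of commuting elements indexed by (Z/N)^I *)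

Section UnitVectors.
Variables (I : finType) (n : nat).

Definition unit_vec (i : I) : {ffun I -> 'I_n.+2} := [ffun j => (j == i)%:R].

Lemma unit_vec_inj : injective unit_vec.
Proof.
move=> i j /ffunP/(_ i); rewrite !ffunE eqxx.
by case: eqP => // _ /eqP; rewrite oner_eq0.
Qed.

Lemma ffun_sum_unit_vec (a : {ffun I -> 'I_n.+2}) :
  exists s : seq I, a = \sum_(i <- s) unit_vec i.
Proof.
exists (flatten [seq nseq (a i) i | i <- enum I]).
rewrite big_flatten big_map big_enum /=.
under eq_bigr => i _ do rewrite big_nseq iter_addr_0.
apply/ffunP=> j; rewrite sum_ffunE (bigD1 j) //= big1 => [|i /negPf ij].
  by rewrite addr0 ffunMnE ffunE eqxx natr_Zp.
by rewrite ffunMnE ffunE eq_sym ij mul0rn.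
Qed.

Lemma unit_vec_ind (Q : {ffun I -> 'I_n.+2} -> Prop) :
  Q 0 -> (forall a i, Q a -> Q (a + unit_vec i)) -> forall a, Q a.
Proof.
move=> Q0 QS a; have [s ->] := ffun_sum_unit_vec a.
elim/last_ind: s => [|s i IHs]; first by rewrite big_nil.
by rewrite -cats1 big_cat big_seq1; apply: QS.
Qed.

End UnitVectors.

Lemma prodgM_comm (I : finType) (gT : finGroupType) (F G : I -> gT) :
    (forall i j, commute (F i) (G j)) ->
  (\prod_i (F i * G i) = \prod_i F i * \prod_i G i)%g.
Proof.
move=> FG; elim: (index_enum I) => [|i s IHs].
  by rewrite !big_nil mulg1.
have FsG : commute (G i) (\prod_(j <- s) F j)%g.
  elim/big_rec: _ => [|j p _ IHp]; first exact: commute1.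
  exact/commuteM/IHp/commute_sym.
by rewrite !big_cons IHs -!mulgA; congr (_ * _)%g; rewrite !mulgA FsG.
Qed.

Section CommutingProduct.
Variables (I : finType) (gT : finGroupType) (T : I -> gT).
Hypothesis T_comm : forall i j, commute (T i) (T j).
Variables (n : nat).
Hypothesis T_exp : forall i, (T i ^+ n.+2 = 1)%g.

(** The action of (Z/N)^I in which the basis vector i acts as T i. *)
Definition power_prod (a : {ffun I -> 'I_n.+2}) : gT :=
  (\prod_i T i ^+ (a i : nat))%g.

Lemma power_prod0 : power_prod 0 = 1%g.
Proof. by rewrite /power_prod big1 // => i _; rewrite ffunE. Qed.

Lemma power_prodD1 (a : {ffun I -> 'I_n.+2}) i :
  power_prod (a + unit_vec n i) = (power_prod a * T i)%g.
Proof.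
have factorE j : (T j ^+ ((a + unit_vec n i)%R j : nat)
    = T j ^+ (a j : nat) * (if j == i then T i else 1))%g.
  rewrite !ffunE /= expg_mod // expgD; congr (_ * _)%g.
  by case: eqP => [->|_] //=; rewrite modn_small.
rewrite /power_prod (eq_bigr _ (fun j _ => factorE j)).
rewrite prodgM_comm => [|j k]; last first.
  case: (k == i); last exact: commute1.
  exact/commute_sym/commuteX.
by rewrite -big_mkcond big_pred1_eq.
Qed.

End CommutingProduct.

(** * The finite brace of an involutive solution *)

Section InvolutiveSolution.
Variables (X : finType) (r : X * X -> X * X).
Hypothesis r_sol : qybe_solution r.
Hypothesis r_nondeg : nondegenerate_solution r.
Hypothesis r_invol : involutive r.

Lemma sigma_inj x : injective (sigma r x).
Proof. exact: bij_inj (r_nondeg.1 x). Qed.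

Definition sigma_perm x : {perm X} := perm (@sigma_inj x).

Lemma sigma_permE x y : sigma_perm x y = sigma r x y.
Proof. exact: permE. Qed.

Lemma sigma_braid x y z :
  sigma r x (sigma r y z) = sigma r (sigma r x y) (sigma r (tau r y x) z).
Proof.
have [_ _ /(_ (x, y, z))] := r_sol.
rewrite /= /sigma /tau /r1 /r2.
case: (r (x, y)) => x1 y1 /=; case: (r (y, z)) => y2 z2 /=.
case: (r (y1, z)) => y3 z3 /=; case: (r (x, y2)) => x4 y4 /=.
by case: (r (x1, y3)) => x5 y5; case: (r (y4, z2)) => y6 z6 [].
Qed.

Lemma sigma_tau x y : sigma r (sigma r x y) (tau r y x) = x.
Proof.
have := r_invol (x, y); rewrite /sigma /tau.
by case: (r (x, y)) => x1 y1 /= ->.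
Qed.

(** The braid relation with tau eliminated by involutivity, made symmetric by
    taking p and q, rather than q and sigma_q^-1 p, as the arguments. *)
Lemma sigma_exchange p q t :
  sigma r q (sigma r ((sigma_perm q)^-1%g p) t)
    = sigma r p (sigma r ((sigma_perm p)^-1%g q) t).
Proof.
set y := (sigma_perm q)^-1%g p.
have yE : sigma r q y = p by rewrite -[LHS]sigma_permE permKV.
rewrite sigma_braid yE; congr (sigma r p (sigma r _ t)).
by rewrite -{2}(sigma_tau q y) yE -[sigma r p _]sigma_permE permK.
Qed.

(** With y = sigma_x^-1 x one has r (x, y) = (x, y), so that y is both the
    value at x and the value of tau_y at x; tau_y then recovers x. *)
Lemma sigma_diag_inj : injective (fun x => (sigma_perm x)^-1%g x).
Proof.
have tau_diag x : tau r ((sigma_perm x)^-1%g x) x = (sigma_perm x)^-1%g x.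
  apply: (@perm_inj _ (sigma_perm x)); rewrite permKV sigma_permE.
  rewrite -[RHS](sigma_tau x ((sigma_perm x)^-1%g x)); congr sigma.
  by rewrite -[RHS]sigma_permE permKV.
move=> x x' /= xx'; apply: (bij_inj (r_nondeg.2 ((sigma_perm x)^-1%g x))).
by rewrite tau_diag {1 2}xx' tau_diag.
Qed.

(** The product of permutations composes from left to right, so this is
    g sigma_(g^-1 y) as a composite of functions. *)
Definition shift_fun y (g : {perm X}) : {perm X} :=
  (sigma_perm (g^-1 y) * g)%g.

Lemma shift_fun_comm y z g :
  shift_fun y (shift_fun z g) = shift_fun z (shift_fun y g).
Proof.
apply/permP=> t; rewrite /shift_fun !permM !sigma_permE; congr (g _).
by rewrite !invMg !permM sigma_exchange.
Qed.

(** The value h of the shift at g determines h^-1 y, which is the image of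
    g^-1 y under the injective map of [sigma_diag_inj]; hence it determines
    sigma_(g^-1 y), and then g. *)
Lemma shift_fun_inj y : injective (shift_fun y).
Proof.
move=> g g' eq_gg'; have diagE h :
    (shift_fun y h)^-1%g y = (sigma_perm (h^-1%g y))^-1%g (h^-1%g y).
  by rewrite /shift_fun invMg permM.
have eq_y : g^-1%g y = g'^-1%g y.
  by apply: sigma_diag_inj; rewrite /= -!diagE eq_gg'.
by move: eq_gg'; rewrite /shift_fun eq_y => /mulgI.
Qed.

Lemma shift_fun_translate (g h : {perm X}) y :
  shift_fun (g y) (h * g)%g = (shift_fun y h * g)%g.
Proof. by rewrite /shift_fun invMg permM permK mulgA. Qed.

Definition shift_perm y : {perm {perm X}} := perm (@shift_fun_inj y).

Lemma shift_permE y g : shift_perm y g = shift_fun y g.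
Proof. exact: permE. Qed.

Lemma shift_perm_comm y z : commute (shift_perm y) (shift_perm z).
Proof. by apply/permP=> g; rewrite !permM !shift_permE shift_fun_comm. Qed.

(** The modulus N is twice the order of the group: a common exponent of the
    shifts that is at least 2, as the basis vectors must be distinct.  Lowered
    by 2 here, it gives Z/N in the form 'I_n.+2, which carries a ring
    structure. *)
Definition modulus_sub2 : nat := (#|[set: {perm {perm X}}]|.*2).-2.

Lemma shift_perm_exp y : (shift_perm y ^+ modulus_sub2.+2 = 1)%g.
Proof.
have -> : modulus_sub2.+2 = (#|[set: {perm {perm X}}]| * 2)%N.
  by rewrite /modulus_sub2 muln2; case: #|_| (cardG_gt0 [set: {perm {perm X}}]%G).
by rewrite expgM expg_cardG ?inE // expg1n.
Qed.

Local Notation vec := {ffun X -> 'I_modulus_sub2.+2}.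
Implicit Types a b c : vec.

Definition cocycle a : {perm X} := power_prod shift_perm a 1%g.

Lemma cocycle0 : cocycle 0 = 1%g.
Proof. by rewrite /cocycle power_prod0 perm1. Qed.

Lemma cocycleD1 a u : cocycle (a + unit_vec _ u) = shift_fun u (cocycle a).
Proof.
rewrite /cocycle (power_prodD1 shift_perm_comm shift_perm_exp) permM.
exact: shift_permE.
Qed.

Lemma cocycle_unit u : cocycle (unit_vec _ u) = sigma_perm u.
Proof.
rewrite -[unit_vec _ u]add0r cocycleD1 cocycle0.
by rewrite /shift_fun invg1 perm1 mulg1.
Qed.

Definition relabel (g : {perm X}) a : vec := [ffun y => a (g^-1%g y)].

Lemma relabelD g a b : relabel g (a + b) = relabel g a + relabel g b.
Proof. by apply/ffunP=> y; rewrite !ffunE. Qed.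

Lemma relabelN g a : relabel g (- a) = - relabel g a.
Proof. by apply/ffunP=> y; rewrite !ffunE. Qed.

Lemma relabel0 g : relabel g 0 = 0.
Proof. by apply/ffunP=> y; rewrite !ffunE. Qed.

Lemma relabel1 a : relabel 1 a = a.
Proof. by apply/ffunP=> y; rewrite !ffunE invg1 perm1. Qed.

Lemma relabelM g h a : relabel (h * g) a = relabel g (relabel h a).
Proof. by apply/ffunP=> y; rewrite !ffunE invMg permM. Qed.

Lemma relabel_unit g u : relabel g (unit_vec _ u) = unit_vec _ (g u).
Proof. by apply/ffunP=> y; rewrite !ffunE (canF_eq (permK g^-1)) invgK. Qed.

(** Adding the basis vector u to b applies the shift at u to cocycle b, and the
    shift at (cocycle a) u to the left-hand side; these match by
    [shift_fun_translate]. *)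
Lemma cocycle_circle a b :
  cocycle (a + relabel (cocycle a) b) = (cocycle b * cocycle a)%g.
Proof.
elim/unit_vec_ind: b => [|b u IHb].
  by rewrite relabel0 addr0 cocycle0 mul1g.
by rewrite relabelD addrA relabel_unit !cocycleD1 IHb shift_fun_translate.
Qed.

Definition vec_mul a b : vec := relabel (cocycle a) b - b.

Definition vec_inv a : vec := - relabel (cocycle a)^-1 a.

Lemma vec_circleE a b : circle vec_mul a b = a + relabel (cocycle a) b.
Proof. by rewrite /circle /vec_mul addrAC subrK addrC. Qed.

Lemma vec_mulDr : right_distributive vec_mul +%R.
Proof. by move=> a b c; rewrite /vec_mul relabelD opprD addrACA. Qed.

Lemma vec_circleA : associative (circle vec_mul).
Proof.
move=> a b c; rewrite !vec_circleE cocycle_circle relabelD relabelM.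
by rewrite addrA.
Qed.

Lemma vec_circle0l : left_id 0 (circle vec_mul).
Proof. by move=> a; rewrite vec_circleE cocycle0 relabel1 add0r. Qed.

Lemma vec_circle0r : right_id 0 (circle vec_mul).
Proof. by move=> a; rewrite vec_circleE relabel0 addr0. Qed.

Lemma vec_circleVr : right_inverse 0 vec_inv (circle vec_mul).
Proof.
by move=> a; rewrite vec_circleE relabelN -relabelM mulVg relabel1 subrr.
Qed.

Lemma cocycle_inv a : cocycle (vec_inv a) = (cocycle a)^-1%g.
Proof.
apply: (mulIg (cocycle a)); rewrite mulVg -cocycle_circle -vec_circleE.
by rewrite vec_circleVr cocycle0.
Qed.

Lemma vec_circleVl : left_inverse 0 vec_inv (circle vec_mul).
Proof. by move=> a; rewrite vec_circleE cocycle_inv addNr. Qed.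

Definition solution_brace : leftBrace :=
  LeftBrace vec_mulDr vec_circleA vec_circle0l vec_circle0r
    vec_circleVl vec_circleVr.

(** The values of the cocycle form a group containing every sigma_v and its
    inverse, so its orbits are unions of sigma-orbits; tau_y x stays in the
    orbit of x because sigma_(sigma_x y) sends it to x. *)
Lemma cocycle_transitive x u : indecomposable r -> exists a, cocycle a x = u.
Proof.
move=> indec.
pose O := [set v | [exists a, cocycle a x == v]].
have OP v : reflect (exists a, cocycle a x = v) (v \in O).
  by rewrite inE; apply: 'exists_eqP.
have O_stable b v : v \in O -> cocycle b v \in O.
  case/OP=> a <-; apply/OP; exists (circle vec_mul b a).
  by rewrite vec_circleE cocycle_circle permM.
have O_sigma v w : (sigma r v w \in O) = (w \in O).
  have sigmaE : sigma r v w = cocycle (unit_vec _ v) w.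
    by rewrite cocycle_unit sigma_permE.
  rewrite sigmaE; apply/idP/idP; last exact: O_stable.
  by move/(O_stable (vec_inv (unit_vec _ v))); rewrite cocycle_inv permK.
have O_tau v w : (tau r v w \in O) = (w \in O).
  by rewrite -(O_sigma (sigma r w v)) sigma_tau.
apply/OP; apply/negPn/negP=> notOu; apply: indec.
exists (fun i : bool => if i then O else ~: O); split.
- case; apply/set0Pn; last by exists u; rewrite inE.
  by exists x; apply/OP; exists 0; rewrite cocycle0 perm1.
- by rewrite disjoints_subset.
- by rewrite setUC setUCr.
move=> i j; rewrite (can2_imset_pre _ r_invol r_invol).
apply/setP=> -[v w]; rewrite !inE.
rewrite -[(r (v, w)).1]/(sigma r v w) -[(r (v, w)).2]/(tau r w v).
have O_part (k : bool) (t t' : X) : (t \in O) = (t' \in O) ->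
    (t \in if k then O else ~: O) = (t' \in if k then O else ~: O).
  by case: k => // tt'; rewrite !in_setC tt'.
by rewrite (O_part i _ _ (O_sigma v w)) (O_part j _ _ (O_tau w v)) andbC.
Qed.

End InvolutiveSolution.

Theorem theorem27 (X : finType) (r : X * X -> X * X)
    (r_sol : qybe_solution r) (r_nondeg : nondegenerate_solution r)
    (r_invol : involutive r) :
  indecomposable r <->
  exists (A : leftBrace) (iota : X -> A) (x : A),
    [/\ injective iota,
        (forall b : A, (exists u : X, b = iota u) <->
                       (exists a : A, b = x + brace_mul a x)),
        (forall a : A, exists s : seq X, a = \sum_(u <- s) iota u) &
        (forall u v : X,
            (iota (r (u, v)).1, iota (r (u, v)).2)
              = yang_baxter_map (iota u, iota v))].
Proof.
split=> [indec|[A [iota [x [iota_inj orbitX sumX ybX]]]]]; last first.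
  apply: (@brace_indecomposable X r A iota x) => // [b|u v]; last first.
    by have [] := ybX u v.
  by split=> [/orbitX[a ->]|[a ->]]; [|apply/orbitX]; exists a; rewrite addrC.
have /card_gt0P[x0 _] : (0 < #|X|)%N by case: r_sol.
pose vec := @unit_vec X (modulus_sub2 X).
exists (solution_brace r_sol r_nondeg r_invol), vec, (vec x0).
rewrite {}/vec; split.
- exact: unit_vec_inj.
- move=> b; split=> [[u ->]|[a ->]].
    have [a <-] := cocycle_transitive r_sol r_nondeg r_invol x0 u indec.
    by exists a; rewrite /= /vec_mul relabel_unit addrC subrK.
  by eexists; rewrite /= /vec_mul relabel_unit addrC subrK.
- exact: ffun_sum_unit_vec.
move=> u v; rewrite /= /vec_mul !subrK !relabel_unit (cocycle_inv r_sol).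
rewrite !(cocycle_unit r_sol) sigma_permE; congr (_, unit_vec _ _).
apply: (@perm_inj _ (sigma_perm r_nondeg (sigma r u v))).
by rewrite permKV sigma_permE sigma_tau.
Qed.
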